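(* Let $(\Omega,\Sigma,\mu)$ be a finite and positive measure space, let $(\mathcal{X},\|\cdot\|)$ be a separable Banach space, and let $r>0$. Assume $p_*>1$ and $\varepsilon\in(0,\sigma_* )$. Then for every $p\in(p_*-\delta_*(\varepsilon),p_*+\delta_*(\varepsilon))$ the inclusion $$B_{\Omega,\mathcal{X},p_*}(r)\subset B_{\Omega,\mathcal{X},p}(r)+\varepsilon B_{\Omega,\mathcal{X},1}(1)$$ holds, where $\sigma_*>0$ and $\delta_*(\varepsilon)\in\left(0,\frac{p_*-1}{2}\right]$ are the numbers given in the context.
   Context: For $p\ge 1$, $L_p(\Omega,\Sigma,\mu;\mathcal{X})$ is the Bochner space of (equivalence classes of) $\mu$-measurable functions $x:\Omega\to\mathcal{X}$ with $\|x\|_p=\left(\int_\Omega\|x(s)\|^p\mu(ds)\right)^{1/p}<+\infty$, and for $\rho>0$, $B_{\Omega,\mathcal{X},p}(\rho)=\{x\in L_p(\Omega,\Sigma,\mu;\mathcal{X}):\|x\|_p\le \rho\}$. Since $\mu$ is finite, $L_p\subset L_1$; sums of sets are Minkowski sums in $L_1$. For fixed $p_*>1$ and $\varepsilon>0$ put $$c_*=\max\left\{\max\left\{r^{\frac{p-p_*}{p}}:p\in[p_*,2p_*]\right\},\ \max\left\{r^{\frac{p_*-p}{p_*}}:p\in\left[\tfrac{p_*+1}{2},p_*\right]\right\}\right\},$$ $$d_*=(\mu(\Omega)+1)(c_*+1),\qquad \alpha_*(\varepsilon)=\max\left\{2r,\ r\left(\tfrac{8r}{\varepsilon}\right)^{\frac{2}{p_*-1}}\right\},$$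 $$\sigma_*=\min\left\{\tfrac r2,\ 4d_*,\ 4r\mu(\Omega),\ 4d_*\sqrt r\right\}.$$ For $\varepsilon\in(0,\sigma_* )$ put $\alpha_1=2\alpha_*(\varepsilon)$, $\alpha_2=3\alpha_*(\varepsilon)$, $\kappa=\frac{\varepsilon}{4\alpha_1\mu(\Omega)}$, $b=\frac{\varepsilon}{4r\mu(\Omega)}$, $h=\frac{64rd_*^2}{\varepsilon^2}$, and $$\delta_1(\varepsilon)=\min\left\{p_*\left[1-\tfrac{1}{1+\log_{b}(1-\kappa)}\right],\ p_*\left[1-\tfrac{1}{1+\log_{\alpha_1/r}(1+\kappa)}\right],\ p_*\left[1-\tfrac{1}{1+\log_{\alpha_1/r}(\alpha_2/\alpha_1)}\right],\ \tfrac{p_*-1}{2}\right\},$$ $$\delta_2(\varepsilon)=\min\left\{p_*\left[\tfrac{1}{1-\log_{r/\alpha_1}(1-\kappa)}-1\right],\ p_*\left[\tfrac{1}{1-\log_{h}(1+\kappa)}-1\right],\ p_*\right\},$$ $$\delta_*(\varepsilon)=\min\{\delta_1(\varepsilon),\delta_2(\varepsilon)\}.$$ *)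

(* Defs.v *)
From HB Require Import structures.
From mathcomp Require Import all_boot all_order all_algebra.
From mathcomp Require Import all_classical all_reals all_analysis.

Set Implicit Arguments.
Unset Strict Implicit.
Unset Printing Implicit Defensive.

Import Order.TTheory GRing.Theory Num.Theory.
Import numFieldNormedType.Exports.

Local Open Scope classical_set_scope.
Local Open Scope ring_scope.

Definition separable (T : topologicalType) : Prop :=
  exists2 D : set T, countable D & dense D.

Section bochner_ball.
Context (R : realType) (d : measure_display) (Omega : measurableType d).
Context (mu : {measure set Omega -> \bar R}) (X : normedModType R).

Definition simple_function (s : Omega -> X) : Prop :=
  finite_set (range s) /\ forall v : X, measurable (s @^-1` [set v]).

(* [mu]-measurability in the sense of Bochner integration. *)
Definition mu_measurable (x : Omega -> X) : Prop :=
  exists2 s_ : nat -> Omega -> X,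
    (forall n, simple_function (s_ n)) &
    {ae mu, forall t, s_ n t @[n --> \oo] --> x t}.

(* [t |-> `|x t|] need only agree a.e. with a measurable function. As the
   integral in [Lnorm] is a supremum over the nonnegative simple functions
   below the integrand, it is insensitive to null sets and is the integral
   with respect to the completion of [mu]. *)
Definition bochner_norm (p : R) (x : Omega -> X) : \bar R :=
  Lnorm mu p%:E (fun t => (`|x t|)%:E).

(* Elements of L_p are handled through their representatives: the ball is the
   set of all representatives of its classes, and equality between functions
   is equality a.e. *)
Definition bochner_ball (p rho : R) : set (Omega -> X) :=
  [set x | mu_measurable x /\ (bochner_norm p x <= rho%:E)%E].

Definition minkowski_sum (A B : set (Omega -> X)) : set (Omega -> X) :=
  [set z | exists2 x, A x & exists2 y, B y & z = x \+ y %[ae mu]].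

Definition dilate (c : R) (A : set (Omega -> X)) : set (Omega -> X) :=
  [set c \*: z | z in A].

End bochner_ball.

Arguments bochner_ball {R d Omega} mu X p rho.

Section constants.
Context (R : realType).

Definition logb (b x : R) : R := ln x / ln b.

(* Below, [m] stands for [mu(Omega)] and [q] for [p_*]. *)
Variables (m r q : R).

(* The two inner maxima are suprema of continuous functions of [p] over
   nonempty compact intervals, hence attained. *)
Definition c_star : R :=
  Num.max (sup [set r `^ ((p - q) / p) | p in `[q, 2 * q]])
          (sup [set r `^ ((q - p) / q) | p in `[(q + 1) / 2, q]]).

Definition d_star : R := (m + 1) * (c_star + 1).

Definition alpha_star (eps : R) : R :=
  Num.max (2 * r) (r * (8 * r / eps) `^ (2 / (q - 1))).

Definition sigma_star : R :=
  Num.min (r / 2)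
    (Num.min (4 * d_star)
       (Num.min (4 * r * m) (4 * d_star * Num.sqrt r))).

Definition delta1 (eps : R) : R :=
  let alpha1 := 2 * alpha_star eps in
  let alpha2 := 3 * alpha_star eps in
  let kappa := eps / (4 * alpha1 * m) in
  let b := eps / (4 * r * m) in
  Num.min (q * (1 - 1 / (1 + logb b (1 - kappa))))
    (Num.min (q * (1 - 1 / (1 + logb (alpha1 / r) (1 + kappa))))
       (Num.min (q * (1 - 1 / (1 + logb (alpha1 / r) (alpha2 / alpha1))))
          ((q - 1) / 2))).

Definition delta2 (eps : R) : R :=
  let alpha1 := 2 * alpha_star eps in
  let kappa := eps / (4 * alpha1 * m) in
  let h := 64 * r * d_star ^+ 2 / eps ^+ 2 in
  Num.min (q * (1 / (1 - logb (r / alpha1) (1 - kappa)) - 1))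
    (Num.min (q * (1 / (1 - logb h (1 + kappa)) - 1)) q).

Definition delta_star (eps : R) : R := Num.min (delta1 eps) (delta2 eps).

End constants.

(* Main.v *)
Require Import Defs.
From HB Require Import structures.
From mathcomp Require Import all_boot all_order all_algebra.
From mathcomp Require Import all_classical all_reals all_analysis.
From mathcomp Require Import measurable_realfun ring lra.

(* Given x with |x|_q <= r, put e = q/p - 1 and y = (|x|/r)^e x. Then
   |y|^p = r^(p - q) |x|^q pointwise, so |y|_p <= r. Writing T = |x|/r, the
   error |x - y| = r |T - T^(1 + e)| is estimated pointwise by
   eps/(2 mu(Omega)) + (eps/4) T^q, and the integral of T^q is at most 1. For
   small T both T and T^(1 + e) are small, for T in the middle range T^e is
   within kappa of 1 by the choice of delta_star, and for T > alpha1/r both T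
   and T^(1 + e) are at most (alpha1/r)^(-(q - 1)/2) T^q. *)

Import Order.TTheory GRing.Theory Num.Theory.
Import numFieldNormedType.Exports.

Local Open Scope classical_set_scope.
Local Open Scope ring_scope.

(** * Integrals of nonnegative functions that need not be measurable *)

Section nonnegative_integral.
Import HBNNSimple.
Context (R : realType) (d : measure_display) (T : measurableType d).
Context (mu : {measure set T -> \bar R}).

(** The integral of a nonnegative function is a supremum over the simple functions below it, and
    enlarging the function only enlarges that family. *)
Lemma ge0_le_integral_nonmeasurable (D : set T) (f g : T -> \bar R) :
  (forall t, D t -> 0 <= f t)%E -> (forall t, D t -> f t <= g t)%E ->
  (\int[mu]_(t in D) f t <= \int[mu]_(t in D) g t)%E.
Proof.
move=> f0 fg.
have g0 t : D t -> (0 <= g t)%E by move=> Dt; exact: le_trans (f0 t Dt) (fg t Dt).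
rewrite !ge0_integralE//; apply: ereal_sup_le => _ [h hf <-].
exists h => //= t; apply: le_trans (hf t) _; rewrite !patchE.
by case: ifPn => //; rewrite inE; exact: fg.
Qed.

(* [f] need not be measurable: each simple function below [f] may be cut off
   on the null set [N] without changing its integral. *)
Lemma ge0_integral_setC_null (N : set T) (f : T -> \bar R) :
  measurable N -> mu N = 0 -> (forall t, 0 <= f t)%E ->
  (\int[mu]_t f t = \int[mu]_(t in ~` N) f t)%E.
Proof.
move=> mN N0 f0; apply/eqP; rewrite eq_le; apply/andP; split.
  rewrite (ge0_integralTE _ f0); apply: ge_ereal_sup => _ [h /= hf <-].
  have := integral_nnsfun mu measurableT h; rewrite patch_setT => <-.
  rewrite (ge0_negligible_integral (N := N))//; last 2 first.
  - by apply/measurable_EFinP; exact: measurable_funP.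
  - by move=> t _; rewrite lee_fin fun_ge0.
  rewrite setTD; apply: ge0_le_integral_nonmeasurable => t _ //.
  by rewrite lee_fin fun_ge0.
rewrite integral_mkcond; apply: ge0_le_integral_nonmeasurable => t _.
  by rewrite erestrict_ge0.
by rewrite patchE; case: ifPn.
Qed.

End nonnegative_integral.

(** * Bochner measurability and integral bounds that follow from it *)

Section mu_measurable.
Context (R : realType) (d : measure_display) (T : measurableType d).
Context (mu : {measure set T -> \bar R}) (X : normedModType R).

(** The preimage is a finite union of level sets, so [A] may be arbitrary and [X] carries no
    sigma-algebra. *)
Lemma simple_function_preimage (s : T -> X) (A : set X) :
  simple_function s -> measurable (s @^-1` A).
Proof.
move=> [fs ms].
have -> : s @^-1` A = \bigcup_(v in range s `&` A) (s @^-1` [set v]).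
  apply/seteqP; split => t /=; first by move=> At; exists (s t).
  by move=> [v [_ Av] /= ->].
by apply: fin_bigcup_measurable => //; exact: finite_setIl.
Qed.

Lemma simple_function_comp (s : T -> X) (G : X -> X) :
  simple_function s -> simple_function (G \o s).
Proof.
move=> ss; split.
  by rewrite -(image_comp s G); apply: finite_image; exact: ss.1.
by move=> v; rewrite comp_preimage; exact: simple_function_preimage.
Qed.

Lemma mu_measurable_comp (x : T -> X) (G : X -> X) :
  continuous G -> mu_measurable mu x -> mu_measurable mu (G \o x).
Proof.
move=> cG [s ss sx]; exists (fun n => G \o s n).
  by move=> n; exact: simple_function_comp.
by apply: filterS sx => t st; exact: (cvg_comp _ _ st (cG _)).
Qed.

(** Off an exceptional null set, the norm is a pointwise limit of norms of simple functions. Since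
    [mu] need not be complete, measurability is claimed only on the complement of that set. *)
Lemma mu_measurable_norm (x : T -> X) : mu_measurable mu x ->
  exists N, [/\ measurable N, mu N = 0 &
    measurable_fun (~` N) (fun t => `|x t|)].
Proof.
move=> [s ss [N [mN N0 sN]]]; exists N; split => //.
apply: (@measurable_fun_cvg _ _ _ _ (fun n t => `|s n t|)).
  move=> n _ Y mY; apply: measurableI; first exact: measurableC.
  exact: (simple_function_preimage _ (fun v => Y `|v|) (ss n)).
move=> t Nt; apply: cvg_norm; apply: contrapT => st.
by apply: Nt; apply: sN.
Qed.

(** Once the null set is removed from both integrals, the majorant is measurable and its integral
    splits by linearity; for [g] itself monotonicity suffices. This one bound serves for both the
    norm of the approximant and the norm of the error. *)
Lemma mu_measurable_integral_le (x : T -> X) (g : T -> R) (a b q : R) :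
  mu_measurable mu x -> 0 <= a -> 0 <= b ->
  (forall t, 0 <= g t <= a + b * `|x t| `^ q) ->
  (\int[mu]_t (g t)%:E <=
   a%:E * mu setT + b%:E * \int[mu]_t (`|x t| `^ q)%:E)%E.
Proof.
move=> mx a0 b0 gab; have [N [mN N0 mxN]] := mu_measurable_norm _ mx.
have g0 t : 0 <= g t by case/andP: (gab t).
rewrite !(ge0_integral_setC_null _ _ _ _ _ _ mN N0); last 2 first.
- by move=> t; rewrite lee_fin powR_ge0.
- by move=> t; rewrite lee_fin.
have mNC : measurable (~` N) by exact: measurableC.
have mq : measurable_fun (~` N) (fun t => (`|x t| `^ q)%:E).
  apply/measurable_EFinP.
  exact: (measurableT_comp (@measurable_powR R q) mxN).
apply: (@le_trans _ _
    (\int[mu]_(t in ~` N) (a%:E + b%:E * (`|x t| `^ q)%:E))%E).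
  apply: ge0_le_integral_nonmeasurable => t _; first by rewrite lee_fin.
  by rewrite -EFinM -EFinD lee_fin; case/andP: (gab t).
rewrite ge0_integralD//; last 2 first.
- by move=> t _; rewrite mule_ge0// lee_fin// powR_ge0.
- exact: measurable_funeM.
rewrite ge0_integralZl_EFin//.
apply: leeD; last exact: lexx.
by rewrite integral_cst// lee_wpmul2l// le_measure// inE.
Qed.

End mu_measurable.

(** Trades the norm for the integral of its power, so that the proof only handles integrals. *)
Lemma bochner_norm_leE (R : realType) (d : measure_display) (T : measurableType d)
    (mu : {measure set T -> \bar R}) (X : normedModType R) (p rho : R)
    (x : T -> X) : 0 < p -> 0 <= rho ->
  (bochner_norm mu p x <= rho%:E)%E =
  (\int[mu]_t (`|x t| `^ p)%:E <= (rho `^ p)%:E)%E.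
Proof.
move=> p0 rho0; set N := bochner_norm mu p x.
have N0 : (0 <= N)%E by exact: Lnorm_ge0.
have <- : (N `^ p = \int[mu]_t (`|x t| `^ p)%:E)%E.
  rewrite poweR_Lnorm ?gt_eqF//; apply: eq_integral => t _ /=.
  by rewrite normr_id.
apply/idP/idP => [Nrho|].
  rewrite -poweR_EFin; apply: gt0_ler_poweR => //; first exact: ltW.
    by rewrite in_itv/= N0 leey.
  by rewrite in_itv/= lee_fin rho0 leey.
(* By contraposition: a finite norm above [rho] is handled by strict monotonicity of the power, and
   an infinite norm has an infinite power. *)
apply: contraTT; rewrite -!ltNge.
case: N N0 => [n| |]//= n0; last by rewrite gt_eqF// => _; rewrite ltry.
by rewrite !lte_fin => rn; rewrite gt0_ltr_powR// nnegrE.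
Qed.

(** * Real powers, and the pointwise error split into three ranges *)

Section powers.
Context (R : realType).
Implicit Types (a e k q s t x y : R).

Lemma powR_le_logb a x y : 1 < a -> 0 < x -> y <= logb a x -> a `^ y <= x.
Proof.
move=> a1 x0; have a0 : 0 < a by lra.
rewrite /logb ler_pdivlMr ?ln_gt0// => yax.
by rewrite /powR gt_eqF// -[leRHS]lnK ?ler_expR// posrE.
Qed.

(** For a base below 1 the logarithm of the base is negative, which reverses the inequality. *)
Lemma powR_ge_logb a x y : 0 < a < 1 -> 0 < x -> y <= logb a x -> x <= a `^ y.
Proof.
move=> /andP[a0 a1] x0; have la : ln a < 0 by rewrite ln_lt0// a0.
rewrite /logb ler_ndivlMr// => yax.
by rewrite /powR gt_eqF// -[leLHS]lnK ?ler_expR// posrE.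
Qed.

(** The three terms on the right bound the error for [t] at most [b], between [b] and [A], and above
    [A]. In the middle range it is enough to control the power [e] at the two endpoints, because it
    is monotone in [t]. In the tail, [s] is the exponent gained against [t] to the power [q]. *)
Lemma powR_near1_error C k b A e s q t :
  0 < b < 1 -> 1 < A -> 0 <= s -> s + 1 <= q -> s + (1 + e) <= q ->
  0 <= k -> b <= C -> b `^ (1 + e) <= C -> 0 < 1 + e ->
  `|1 - b `^ e| <= k -> `|1 - A `^ e| <= k -> 0 <= t ->
  `|t - t * t `^ e| <= C + k * A + A `^ (- s) * t `^ q.
Proof.
move=> /andP[b0 b1] A1 s0 sq seq k0 bC beC e0 bk Ak t0.
have kA : 0 <= k * A by rewrite mulr_ge0//; lra.
have At0 : 0 <= A `^ (- s) * t `^ q by rewrite mulr_ge0// powR_ge0.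
have [->|tn0] := eqVneq t 0; first by
  rewrite mul0r subr0 normr0 !addr_ge0// ?(le_trans _ bC) ?(ltW b0) ?mulr_ge0 ?powR_ge0.
have {t0}tp : 0 < t by rewrite lt_def tn0.
have te : t * t `^ e = t `^ (1 + e).
  by rewrite powRD ?powRr1// ?ltW//; rewrite tn0 implybT.
have dist (u v w : R) : 0 <= u <= w -> 0 <= v <= w -> `|u - v| <= w.
  by move=> uw vw; rewrite ler_norml; lra.
have [tb|bt] := leP t b.
  suff : `|t - t * t `^ e| <= C by lra.
  apply: dist; first by lra.
  rewrite te powR_ge0 (le_trans _ beC)// ge0_ler_powR//; first exact: ltW.
  - by rewrite nnegrE ltW.
  - by rewrite nnegrE ltW.
have [tA|At] := leP t A.
  suff : `|t - t * t `^ e| <= k * A by lra.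
  rewrite -{1}[t]mulr1 -mulrBr normrM gtr0_norm// mulrC.
  rewrite ler_pM//; first exact: ltW.
  (* The sign of [e] decides which endpoint bounds the power from above; in both cases it lies
     between the values at [b] and [A]. *)
  have [e_ge0|/ltW e_le0] := leP 0 e.
    have h1 : b `^ e <= t `^ e by rewrite ge0_ler_powR// ?nnegrE ltW.
    have h2 : t `^ e <= A `^ e by rewrite ge0_ler_powR// ?nnegrE; lra.
    by move: bk Ak; rewrite !ler_norml; lra.
  have neg x y : 0 < x -> x <= y -> y `^ e <= x `^ e.
    move=> x0 xy; rewrite -[e]opprK !(powRN _ (- e)) lef_pV2 ?posrE ?powR_gt0//.
      by rewrite ge0_ler_powR// ?nnegrE; lra.
    lra.
  have h1 := neg _ _ b0 (ltW bt).
  have h2 := neg _ _ tp tA.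
  by move: bk Ak; rewrite !ler_norml; lra.
suff : `|t - t * t `^ e| <= A `^ (- s) * t `^ q by lra.
(* Since [t] is at least 1, both [t] and its power [1 + e] are at most its power [q - s]. *)
have t1 : 1 <= t by lra.
have tqs : t `^ (q - s) <= A `^ (- s) * t `^ q.
  rewrite powRD; last by rewrite tn0 implybT.
  rewrite mulrC ler_wpM2r ?powR_ge0// !powRN lef_pV2 ?posrE ?powR_gt0//; last lra.
  by rewrite ge0_ler_powR// ?nnegrE; lra.
apply: le_trans tqs; apply: dist.
  rewrite (ltW tp)/= -{1}[t]powRr1; last lra.
  by apply: ler_powR => //; lra.
by rewrite te powR_ge0/=; apply: ler_powR => //; lra.
Qed.

End powers.

(** * The radial map that produces the approximant *)

Section rescaling.
Context (R : realType) (X : normedModType R).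
Implicit Types (r e p q eps : R) (v : X).

(** With [e = q / p - 1] this is the Mazur map from [L_q] to [L_p], applied to values and normalised
    to fix the sphere of radius [r]. *)
Definition rescale r e v : X := (`|v| / r) `^ e *: v.

Lemma norm_rescale_powR r p q v : 0 < r -> 0 < p -> 0 < q ->
  `|rescale r (q / p - 1) v| `^ p = r `^ p * (`|v| / r) `^ q.
Proof.
move=> r0 p0 q0; rewrite /rescale normrZ ger0_norm ?powR_ge0//.
have [->|v0] := eqVneq v 0.
  by rewrite normr0 mul0r mulr0 !powR0 ?mulr0// gt_eqF.
have n0 : 0 < `|v| / r by rewrite divr_gt0// normr_gt0.
have {2}-> : `|v| = r * (`|v| / r) by field; rewrite gt_eqF.
rewrite mulrCA powRM ?(ltW r0)//; last by rewrite mulr_ge0 ?powR_ge0// ltW.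
congr (_ * _); rewrite -{2}[`|v| / r]powRr1 ?ltW//.
rewrite -powRD; last by rewrite (gt_eqF n0) implybT.
by rewrite -powRrM; congr (_ `^ _); field; rewrite gt_eqF.
Qed.

Lemma norm_sub_rescale r e v (t := `|v| / r) : 0 < r ->
  `|v - rescale r e v| = r * `|t - t * t `^ e|.
Proof.
move=> r0; rewrite /rescale -/t -{1}[v]scale1r -scalerBl normrZ.
rewrite -{2}[t]mulr1 -mulrBr normrM [`|t|]ger0_norm ?divr_ge0// ?ltW//.
by rewrite /t; field; rewrite gt_eqF.
Qed.

(** Only the origin is delicate, since the scalar factor blows up there when [e] is negative. The
    norm of the image is [r] times the power [1 + e] of [|v| / r], which still tends to 0 because
    [1 + e] is positive. *)
Lemma continuous_rescale r e : 0 < r -> 0 < 1 + e -> continuous (rescale r e).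
Proof.
move=> r0 e0 v; have [->|v0] := eqVneq v 0; last first.
  apply: cvgZ; last exact: cvg_id.
  have n0 : 0 < `|v| / r by rewrite divr_gt0// normr_gt0.
  apply: (@continuous_comp _ _ _ (fun v => `|v| / r) (fun u => u `^ e)).
    by apply: cvgMl; exact: norm_continuous.
  apply: differentiable_continuous; apply/derivable1_diffP.
  by apply: derivable_powR; rewrite in_itv/= andbT.
have r00 : rescale r e 0 = 0 by rewrite /rescale scaler0.
rewrite /continuous_at r00; apply/cvgr0Pnorm_lt => eps eps0.
(* This radius solves [r * (del / r)^(1 + e) = eps]. *)
pose del := r * (eps / r) `^ (1 + e)^-1.
have del0 : 0 < del by rewrite mulr_gt0// powR_gt0// divr_gt0.
near=> w.
have wdel : `|w| < del by near: w; exact: nbhs0_lt.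
rewrite normrZ ger0_norm ?powR_ge0//.
have [->|w0] := eqVneq w 0; first by rewrite normr0 mulr0.
have n0 : 0 < `|w| / r by rewrite divr_gt0// normr_gt0.
have -> : (`|w| / r) `^ e * `|w| = r * (`|w| / r) `^ (1 + e).
  rewrite powRD ?powRr1 ?(ltW n0)//; last by rewrite (gt_eqF n0) implybT.
  by field; rewrite gt_eqF.
rewrite mulrC -ltr_pdivlMr//.
have -> : eps / r = ((eps / r) `^ (1 + e)^-1) `^ (1 + e).
  by rewrite -powRrM mulVf ?gt_eqF// powRr1// ltW// divr_gt0.
rewrite gt0_ltr_powR// ?nnegrE ?(ltW n0) ?powR_ge0//.
by rewrite ltr_pdivrMr// mulrC.
Unshelve. all: by end_near. Qed.

End rescaling.

(** * Numerical bounds on the constants, and the resulting pointwise estimate *)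

Section constants.
Context (R : realType) (m r q : R).
Hypotheses (m_gt0 : 0 < m) (r_gt0 : 0 < r) (q_gt1 : 1 < q).

(** The choice [p = 2 * q] in the first supremum gives the exponent 1/2. *)
Lemma sqrt_le_c_star : Num.sqrt r <= c_star r q.
Proof.
move: r_gt0 q_gt1 => r0 q1.
rewrite /c_star le_max; apply/orP; left; apply: ub_le_sup.
  (* The supremum dominates its elements only once the set is known to be bounded. The exponent lies
     in [0, 1], so every power is at most the larger of 1 and [r]. *)
  exists (1 + r) => _ [p + <-]; rewrite /= in_itv/= => /andP[qp p2q].
  have p0 : 0 < p by lra.
  have e0 : 0 <= (p - q) / p by rewrite divr_ge0//; lra.
  have e1 : (p - q) / p <= 1 by rewrite ler_pdivrMr//; lra.
  have [r1|/ltW r1] := leP r 1.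
    suff : r `^ ((p - q) / p) <= r `^ 0 by rewrite powRr0; lra.
    by apply: ger_powR => //; rewrite r0.
  suff : r `^ ((p - q) / p) <= r `^ 1 by rewrite powRr1; lra.
  exact: ler_powR.
exists (2 * q); first by rewrite /= in_itv/=; lra.
by rewrite -powR12_sqrt ?ltW//; congr (_ `^ _); field; lra.
Qed.

Lemma c_star_ge0 : 0 <= c_star r q.
Proof. exact: le_trans (sqrtr_ge0 r) sqrt_le_c_star. Qed.

Lemma d_star_gt0 : 0 < d_star m r q.
Proof.
move: m_gt0 c_star_ge0 => m0 c0.
by rewrite /d_star mulr_gt0//; lra.
Qed.

Lemma sigma_star_gt0 : 0 < sigma_star m r q.
Proof.
have sr : 0 < Num.sqrt r by rewrite sqrtr_gt0.
rewrite /sigma_star; move: (d_star m r q) d_star_gt0 => d d0.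
by rewrite !lt_min divr_gt0// !mulr_gt0.
Qed.

Variable eps : R.
Hypothesis eps_sigma : 0 < eps < sigma_star m r q.

Let eps_gt0 : 0 < eps.
Proof. by case/andP: eps_sigma. Qed.

Let alpha1 := 2 * alpha_star r q eps.
Let A := alpha1 / r.
Let kappa := eps / (4 * alpha1 * m).
Let b := eps / (4 * r * m).
Let h := 64 * r * d_star m r q ^+ 2 / eps ^+ 2.

Let eps_lt : [/\ eps < r / 2, eps < 4 * d_star m r q, eps < 4 * r * m &
  eps < 4 * d_star m r q * Num.sqrt r].
Proof.
by case/andP: eps_sigma => _; rewrite /sigma_star !lt_min => /and4P[].
Qed.

Let A_ge4 : 4 <= A.
Proof.
move: r_gt0 => r0.
rewrite /A /alpha1 ler_pdivlMr//.
suff : 2 * r <= alpha_star r q eps by lra.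
by rewrite /alpha_star le_max lexx.
Qed.

Let alpha1E : alpha1 = A * r.
Proof. by rewrite /A divfK// gt_eqF. Qed.

(** The second entry of the maximum in [alpha_star] is chosen for this: its exponent [2 / (q - 1)]
    cancels against [(q - 1) / 2]. *)
Let A_tail : A `^ (- ((q - 1) / 2)) <= eps / (8 * r).
Proof.
move: r_gt0 q_gt1 eps_gt0 A_ge4 => r0 q1 eps0 A4.
have q0 : 0 < (q - 1) / 2 by lra.
have x0 : 0 < 8 * r / eps by rewrite divr_gt0// mulr_gt0.
have -> : eps / (8 * r) = (8 * r / eps)^-1 by rewrite invf_div.
rewrite powRN lef_pV2 ?posrE ?powR_gt0//; last lra.
have {1}-> : 8 * r / eps = ((8 * r / eps) `^ (2 / (q - 1))) `^ ((q - 1) / 2).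
  rewrite -powRrM; have -> : 2 / (q - 1) * ((q - 1) / 2) = 1 by field; lra.
  by rewrite powRr1// ltW.
rewrite ge0_ler_powR ?nnegrE ?powR_ge0 ?(ltW q0)//; first lra.
rewrite /A ler_pdivlMr// /alpha1.
have : r * (8 * r / eps) `^ (2 / (q - 1)) <= alpha_star r q eps.
  by rewrite /alpha_star le_max lexx orbT.
have : 0 <= r * (8 * r / eps) `^ (2 / (q - 1)).
  by rewrite mulr_ge0 ?powR_ge0// ltW.
lra.
Qed.

Let b_gt0 : 0 < b.
Proof. by rewrite divr_gt0// !mulr_gt0. Qed.

Let b_lt1 : b < 1.
Proof.
by case: eps_lt => _ _ ? _; rewrite ltr_pdivrMr ?mul1r// !mulr_gt0.
Qed.

(** Thus the middle range, where the error is at most [kappa * A], costs as much as the range of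
    small values. *)
Let kappaE : kappa * A = b.
Proof.
move: m_gt0 r_gt0 A_ge4 => m0 r0 A4.
rewrite /kappa /b alpha1E; field.
by rewrite !gt_eqF//; lra.
Qed.

Let kappa_gt0 : 0 < kappa.
Proof.
have A0 : 0 < A by have := A_ge4; lra.
by have := b_gt0; rewrite -kappaE pmulr_lgt0.
Qed.

Let kappa_le : kappa <= 1 / 4.
Proof.
suff : kappa * 4 <= kappa * A by rewrite kappaE; have := b_lt1; lra.
by rewrite ler_wpM2l ?A_ge4// ltW.
Qed.

Let hE : h = (8 * Num.sqrt r * d_star m r q / eps) ^+ 2.
Proof.
move: r_gt0 eps_gt0 => r0 eps0.
rewrite /h -{1}(sqr_sqrtr (ltW r0)); field; lra.
Qed.

Let h_root_gt2 : 2 < 8 * Num.sqrt r * d_star m r q / eps.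
Proof. by case: eps_lt => _ _ _ ?; rewrite ltr_pdivlMr//; lra. Qed.

Let h_gt4 : 4 < h.
Proof. by rewrite hE; have := h_root_gt2; nra. Qed.

(** By [hE] the left side is [eps / (8 * sqrt r * d_star)], so the claim reduces to
    [m * sqrt r <= d_star], which follows from [sqrt r <= c_star]. *)
Let h_tail : h `^ (- 2^-1) <= b / 2.
Proof.
move: m_gt0 r_gt0 eps_gt0 h_root_gt2 => m0 r0 eps0 g2.
rewrite powRN powR12_sqrt; last by have := h_gt4; lra.
rewrite hE sqrtr_sqr ger0_norm; last by lra.
have d0 := d_star_gt0; have s0 : 0 < Num.sqrt r by rewrite sqrtr_gt0.
rewrite invf_div /b ler_pdivrMr; last by rewrite pmulr_rgt0// mulr_gt0.
have -> : eps / (4 * r * m) / 2 * (8 * Num.sqrt r * d_star m r q) =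
          eps * (Num.sqrt r * d_star m r q / (r * m)).
  by field; rewrite !gt_eqF.
rewrite ler_peMr ?(ltW eps0)// ler_pdivlMr ?mulr_gt0// mul1r.
rewrite -{1}(sqr_sqrtr (ltW r0)) expr2 -mulrA ler_pM2l//.
rewrite /d_star; have c := sqrt_le_c_star; have c0 := c_star_ge0.
nra.
Qed.

Let logb_b : 0 < logb b (1 - kappa).
Proof.
have k0 := kappa_gt0; have k1 := kappa_le.
by rewrite /logb ltr_ndivlMr ?mul0r ln_lt0 ?b_gt0 ?b_lt1//; lra.
Qed.

Let logb_A x : 1 < x -> 0 < logb A x.
Proof.
by move=> x1; have A4 := A_ge4; rewrite /logb divr_gt0 ?ln_gt0//; lra.
Qed.

(** The upper bound 1 keeps [1 / (1 - L)] in [delta2] positive, with [L] this logarithm. It holds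
    because [A^-1] is at most 1/4 while [1 - kappa] is at least 3/4. *)
Let logb_invA : 0 < logb A^-1 (1 - kappa) < 1.
Proof.
have A4 := A_ge4; have k0 := kappa_gt0; have k1 := kappa_le.
have iA0 : 0 < A^-1 by rewrite invr_gt0; lra.
have iA : A^-1 <= 4^-1 by rewrite lef_pV2 ?posrE//; lra.
have liA : ln A^-1 < ln (1 - kappa) by rewrite ltr_ln ?posrE//; lra.
have lk : ln (1 - kappa) < 0 by rewrite ln_lt0//; lra.
have liA0 : ln A^-1 < 0 by lra.
by rewrite /logb ltr_ndivlMr// mul0r ltr_ndivrMr// mul1r lk.
Qed.

Let logb_h : 0 < logb h (1 + kappa) < 1.
Proof.
have h4 := h_gt4; have k0 := kappa_gt0; have k1 := kappa_le.
have lh : 0 < ln h by rewrite ln_gt0//; lra.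
have lk : 0 < ln (1 + kappa) by rewrite ln_gt0//; lra.
rewrite /logb divr_gt0//= ltr_pdivrMr// mul1r ltr_ln ?posrE; lra.
Qed.

Let invA : r / alpha1 = A^-1.
Proof. by rewrite /A invf_div. Qed.

Lemma delta_star_gt0 : 0 < delta_star m r q eps.
Proof.
move: r_gt0 q_gt1 => r0 q1.
have A4 := A_ge4; have k0 := kappa_gt0.
have low L : 0 < L -> 0 < q * (1 - 1 / (1 + L)).
  move=> L0; rewrite mulr_gt0//; first lra.
  by rewrite subr_gt0 ltr_pdivrMr; lra.
have high L : 0 < L < 1 -> 0 < q * (1 / (1 - L) - 1).
  move=> L01; rewrite mulr_gt0//; first lra.
  by rewrite subr_gt0 ltr_pdivlMr; lra.
rewrite /delta_star /delta1 /delta2 -/alpha1 -/A -/kappa -/b -/h invA !lt_min.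
apply/andP; split; [apply/and4P|apply/and3P]; split.
- exact: low.
- by apply: low; apply: logb_A; lra.
(* The quotient [alpha2 / alpha1] equals 3/2. *)
- apply: low; apply: logb_A; have : 0 < alpha1 by rewrite alpha1E mulr_gt0; lra.
  by rewrite /alpha1 => a0; rewrite ltr_pdivlMr; lra.
- lra.
- exact: high.
- exact: high.
- lra.
Qed.

Lemma delta_star_le : delta_star m r q eps <= (q - 1) / 2.
Proof. by rewrite /delta_star /delta1 /= !ge_min lexx !orbT. Qed.

(** Each entry of the minimum has the form [q - q / (1 + L)] or [q / (1 - L) - q], so the range of
    [p] gives [q / (1 + L) <= p] or [p <= q / (1 - L)]; these rearrange to the bounds on the
    exponent. *)
Lemma exponent_bounds (p : R) :
  q - delta_star m r q eps < p < q + delta_star m r q eps ->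
  [/\ q / p - 1 <= logb b (1 - kappa), q / p - 1 <= logb A (1 + kappa),
      1 - q / p <= logb A^-1 (1 - kappa) & 1 - q / p <= logb h (1 + kappa)].
Proof.
move: q_gt1 => q1 /andP[pl pr].
have lb := logb_b; have liA := logb_invA; have lh := logb_h.
have lA : 0 < logb A (1 + kappa) by apply: logb_A; have := kappa_gt0; lra.
have dle := delta_star_le; have p0 : 0 < p by lra.
have low L : 0 < L -> delta_star m r q eps <= q * (1 - 1 / (1 + L)) ->
    q / p - 1 <= L.
  move=> L0 dL; suff : q / p <= 1 + L by lra.
  have qL : q * (1 - 1 / (1 + L)) = q - q / (1 + L) by field; lra.
  have : q / (1 + L) <= p by lra.
  by rewrite !ler_pdivrMr// 1?mulrC//; lra.
have high L : 0 < L < 1 -> delta_star m r q eps <= q * (1 / (1 - L) - 1) ->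
    1 - q / p <= L.
  move=> /andP[L0 L1] dL; suff : 1 - L <= q / p by lra.
  have qL : q * (1 / (1 - L) - 1) = q / (1 - L) - q by field; lra.
  have : p <= q / (1 - L) by lra.
  by rewrite !ler_pdivlMr// 1?mulrC//; lra.
(* Unfolding only the right-hand copy bounds [delta_star] by every entry of the minimum. *)
have := lexx (delta_star m r q eps).
rewrite {2}/delta_star /delta1 /delta2 -/alpha1 -/A -/kappa -/b -/h invA.
rewrite !le_min => /andP[/and4P[d1 d2 _ _] /and3P[d3 d4 _]].
by split; [exact: low|exact: low|exact: high|exact: high].
Qed.

(** The small and middle ranges contribute [b] each, and [2 * r * b = eps / (2 * m)]; the tail
    contributes at most [eps / 8] times the power [q] of [t]. The lower cutoff is [b] when [e] is
    nonnegative. When [e] is negative, [b] to the power [1 + e] exceeds [b], so the smaller cutoff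
    [h^-1] is used. *)
Lemma powR_rescaling_error (p t : R) :
  q - delta_star m r q eps < p < q + delta_star m r q eps -> 0 <= t ->
  r * `|t - t * t `^ (q / p - 1)| <= eps / (2 * m) + eps / 4 * t `^ q.
Proof.
move=> pq t0; move: m_gt0 r_gt0 q_gt1 eps_gt0 => m0 r0 q1 eps0.
have A4 := A_ge4; have k0 := kappa_gt0; have k1 := kappa_le; have b0 := b_gt0.
have b1 := b_lt1; have h4 := h_gt4; have A0 : 0 < A by lra.
have [p0 p1 p2] : [/\ 0 < p, (q + 1) / 2 < p & p < 2 * q].
  by have := delta_star_le; case/andP: pq; split; lra.
have [eb eA eiA eh] := exponent_bounds _ pq.
set e := q / p - 1 in eb eA *.
have qp0 : 0 < q / p by rewrite divr_gt0//; lra.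
have e1 : 1 + e = q / p by rewrite /e addrC subrK.
suff err : `|t - t * t `^ e| <=
    b + kappa * A + A `^ (- ((q - 1) / 2)) * t `^ q.
  have : r * `|t - t * t `^ e| <= r * (2 * b + eps / (8 * r) * t `^ q).
    rewrite ler_pM2l// (le_trans err)// kappaE.
    have : A `^ (- ((q - 1) / 2)) * t `^ q <= eps / (8 * r) * t `^ q.
      by rewrite ler_wpM2r ?powR_ge0// A_tail.
    lra.
  have -> : r * (2 * b + eps / (8 * r) * t `^ q) =
            eps / (2 * m) + eps / 8 * t `^ q.
    by rewrite /b; field; rewrite !gt_eqF.
  have : 0 <= eps * t `^ q by rewrite mulr_ge0 ?powR_ge0// ltW.
  lra.
have [e_ge0|e_lt0] := leP 0 e.
  have bA : 1 - kappa <= b `^ e by apply: powR_ge_logb => //; lra.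
  have bB : b `^ e <= b `^ 0 by apply: ger_powR => //; lra.
  have AA : A `^ e <= 1 + kappa by apply: powR_le_logb => //; lra.
  have AB : A `^ 0 <= A `^ e by apply: ler_powR => //; lra.
  move: bB AB; rewrite !powRr0 => bB AB.
  apply: (@powR_near1_error _ b kappa b); rewrite ?b0 ?ler_norml//; try lra.
    (* As [p] exceeds [(q + 1) / 2], this reduces to [q <= ((q + 1) / 2)^2]. *)
    suff : q / p <= (q + 1) / 2 by lra.
    by rewrite ler_pdivrMr//; nra.
  rewrite -[leRHS]powRr1; last lra.
  by apply: ger_powR; lra.
have h0 : 0 < h by lra.
have hV y : h^-1 `^ y = h `^ (- y).
  by rewrite -powR_inv1 ?(ltW h0)// -powRrM mulN1r.
have AV : A^-1 `^ (- e) = A `^ e.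
  by rewrite -powR_inv1 ?(ltW A0)// -powRrM mulrNN mul1r.
have hA : h `^ (- e) <= 1 + kappa by apply: powR_le_logb => //; lra.
have hB : h `^ 0 <= h `^ (- e) by apply: ler_powR => //; lra.
have AA : 1 - kappa <= A `^ e.
  rewrite -AV; apply: powR_ge_logb => //; [|lra|lra].
  by rewrite invr_gt0 A0 invf_lt1//; lra.
have AB : A `^ e <= A `^ 0 by apply: ler_powR => //; lra.
move: hB AB; rewrite !powRr0 => hB AB.
have tail y : y <= - 2^-1 -> h `^ y <= b.
  move=> y2; have := h_tail.
  have : h `^ y <= h `^ (- 2^-1) by apply: ler_powR => //; lra.
  lra.
(* Hence [1 + e] is at least 1/2, and [h_tail] covers both [h^-1] and its power [1 + e]. *)
have e2 : 2^-1 <= q / p by rewrite ler_pdivlMr//; lra.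
apply: (@powR_near1_error _ b kappa h^-1); rewrite ?hV ?ler_norml//; try lra.
- by rewrite invr_gt0 h0 invf_lt1//; lra.
- by rewrite -powR_inv1 ?(ltW h0)//; apply: tail; lra.
- by apply: tail; lra.
Qed.

End constants.

(** * Integration of the pointwise estimates *)

Theorem theorem3p1 (R : realType) (d : measure_display)
    (Omega : measurableType d) (mu : {finite_measure set Omega -> \bar R})
    (mu_pos : (0 < mu [set: Omega])%E)
    (X : completeNormedModType R) (X_sep : separable X)
    (r p_star : R) (r_pos : 0 < r) (p_star_gt1 : 1 < p_star) :
  let m := fine (mu [set: Omega]) in
  0 < sigma_star m r p_star /\
  forall eps : R, 0 < eps < sigma_star m r p_star ->
    0 < delta_star m r p_star eps <= (p_star - 1) / 2 /\
    forall p : R,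
      p_star - delta_star m r p_star eps < p
        < p_star + delta_star m r p_star eps ->
      bochner_ball mu X p_star r `<=`
        minkowski_sum mu (bochner_ball mu X p r)
                         (dilate eps (bochner_ball mu X 1 1)).
Proof.
move=> m; have muE : mu setT = m%:E by rewrite fineK// fin_num_measure.
have m0 : 0 < m by rewrite -lte_fin -muE.
split=> [|eps epsP]; first exact: sigma_star_gt0.
have dle := @delta_star_le R m r p_star eps.
split=> [|p pP x]; first by rewrite delta_star_gt0//=.
have q0 : 0 < p_star by lra.
have p0 : 0 < p by case/andP: pP; lra.
have eps0 : 0 < eps by case/andP: epsP.
rewrite /bochner_ball/= => -[mx]; rewrite bochner_norm_leE// ?(ltW r_pos)// => xr.
set I := (\int[mu]_t _)%E in xr.
have rq : 0 < r `^ p_star by rewrite powR_gt0.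
pose e := p_star / p - 1.
have e0 : 0 < 1 + e by rewrite addrC subrK divr_gt0.
have cG := continuous_rescale _ X r e r_pos e0.
(* The error is divided by [eps] so that it is to be placed in the unit ball of [L_1]. *)
pose H := fun v : X => eps^-1 *: (v - rescale _ X r e v).
have cH : continuous H.
  move=> v; apply: cvgZr; apply: cvgB; [exact: cvg_id|exact: cG].
have powE v : (`|v| / r) `^ p_star = (r `^ p_star)^-1 * `|v : X| `^ p_star.
  rewrite powRM ?invr_ge0 ?(ltW r_pos)// mulrC; congr (_ * _).
  by rewrite -powR_inv1 ?ltW// -powRrM mulN1r powRN.
exists (rescale _ X r e \o x).
  split; first exact: mu_measurable_comp.
  rewrite bochner_norm_leE// ?(ltW r_pos)//.
  (* The factor in the pointwise identity between the power [p] of the norm of the approximant and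
     the power [p_star] of the norm of [x]. *)
  pose c := r `^ p / r `^ p_star.
  have c0 : 0 <= c by rewrite divr_ge0// powR_ge0.
  apply: le_trans
    (mu_measurable_integral_le _ _ _ _ _ _ _ 0 c p_star mx _ c0 _) _ => //.
    move=> t; rewrite powR_ge0/= norm_rescale_powR// powE.
    by rewrite add0r mulrA.
  rewrite mul0e add0e.
  apply: (@le_trans _ _ (c%:E * (r `^ p_star)%:E)%E).
    by rewrite lee_wpmul2l// lee_fin.
  by rewrite -EFinM lee_fin divfK// gt_eqF.
exists (eps \*: (H \o x)); last first.
  apply/aeW => t _ /=; rewrite /H scalerA divff ?gt_eqF// scale1r.
  by rewrite addrC subrK.
exists (H \o x) => //; split; first exact: mu_measurable_comp.
rewrite bochner_norm_leE// powR1.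
(* The coefficients [(2 * m)^-1] and [c] are those of [powR_rescaling_error] divided by [eps], with
   [t = |x| / r]. After integration they contribute 1/2 and at most 1/4, for a total below 1. *)
pose c := (4 * r `^ p_star)^-1.
have c0 : 0 <= c by rewrite invr_ge0 mulr_ge0// ltW.
have a0 : 0 <= (2 * m)^-1 by rewrite invr_ge0 mulr_ge0// ltW.
apply: le_trans
  (mu_measurable_integral_le _ _ _ _ _ _ _ _ c p_star mx a0 c0 _) _ => //.
  move=> t; rewrite powRr1// normr_ge0/= /H normrZ norm_sub_rescale//.
  rewrite gtr0_norm ?invr_gt0// ler_pdivrMl//.
  apply: le_trans (powR_rescaling_error _ _ _ _ m0 r_pos p_star_gt1 _ epsP _ _ pP _) _.
    by rewrite divr_ge0// ltW.
  rewrite powE /c le_eqVlt; apply/orP; left; apply/eqP.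
  by field; rewrite !gt_eqF.
apply: (@le_trans _ _ ((2 * m)^-1%:E * m%:E + c%:E * (r `^ p_star)%:E)%E).
  by rewrite leeD// ?lee_wpmul2l ?lee_fin// -muE.
rewrite -!EFinM -EFinD lee_fin /c.
have -> : (2 * m)^-1 * m + (4 * r `^ p_star)^-1 * r `^ p_star = 2^-1 + 4^-1.
  by field; rewrite !gt_eqF.
lra.
Qed.
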